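(* Let $\lambda$ be an infinite cardinal, let $p:[\lambda^+]^2\to\lambda$ be a partition, and let $\chi\le\operatorname{cf}(\lambda)$ be a cardinal. Then $\mathrm{pr}_1(\lambda^+,\lambda^+,\lambda,\chi)_p$ holds if and only if $\mathrm{pr}_1(\lambda^+,\lambda^+,\lambda^+,\chi)_p$ holds.
   Context: $[\kappa]^2$ denotes the set of pairs $(\alpha,\beta)$ with $\alpha<\beta<\kappa$; a partition is any function $p:[\kappa]^2\to\mu$. For an ordinal $\sigma$, $[\kappa]^\sigma$ is the set of subsets of $\kappa$ of order type $\sigma$. For sets of ordinals $a,b$, $a<b$ means $\alpha<\beta$ for all $\alpha\in a,\beta\in b$. Given a partition $p:[\kappa]^2\to\mu$, a coloring $c:[\kappa]^2\to\theta$ witnesses $\mathrm{pr}_1(\kappa,\kappa,\theta,\chi)_p$ iff for every ordinal $\sigma<\chi$, every pairwise disjoint family $\mathcal A\subseteq[\kappa]^\sigma$ with $|\mathcal A|=\kappa$, and every function $\tau:\mu\to\theta$, there are $a,b\in\mathcal A$ with $a<b$ such that $c(\alpha,\beta)=\tau(p(\alpha,\beta))$ for all $\alpha\in a$ and $\beta\in b$. The principle $\mathrm{pr}_1(\kappa,\kappa,\theta,\chi)_p$ asserts that such a coloring exists. *)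

(* Defs.v *)
(* Cardinals are modelled by types (compared via injections);
   ordinals by well-ordered types; subsets by predicates. *)
From Stdlib Require Import Relations Wellfounded.

Definition inj (A B : Type) : Prop := exists f : A -> B, forall x y, f x = f y -> x = y.

Definition well_order {T : Type} (lt : T -> T -> Prop) : Prop :=
  (forall x, ~ lt x x) /\
  (forall x y z, lt x y -> lt y z -> lt x z) /\
  (forall x y, lt x y \/ x = y \/ lt y x) /\
  well_founded lt.

Definition segment {T : Type} (lt : T -> T -> Prop) (x : T) : Type := {y : T | lt y x}.

Definition subtype_of {T : Type} (X : T -> Prop) : Type := {y : T | X y}.

Definition infinite_cardinal {L : Type} (ltL : L -> L -> Prop) : Prop :=
  well_order ltL /\ inj nat L /\ (forall x : L, ~ inj L (segment ltL x)).

Definition successor_of (L : Type) {K : Type} (ltK : K -> K -> Prop) : Prop :=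
  well_order ltK /\ (forall x : K, inj (segment ltK x) L) /\ ~ inj K L.

Definition le_cf (C : Type) {L : Type} (ltL : L -> L -> Prop) : Prop :=
  forall X : L -> Prop, (forall x, exists y, X y /\ ~ ltL y x) -> inj C (subtype_of X).

Definition has_otype {K S : Type} (ltK : K -> K -> Prop) (ltS : S -> S -> Prop)
  (a : K -> Prop) : Prop :=
  exists g : S -> K, (forall s t, ltS s t -> ltK (g s) (g t)) /\
                     (forall x, a x <-> exists s, g s = x).

Definition set_lt {K : Type} (ltK : K -> K -> Prop) (a b : K -> Prop) : Prop :=
  forall x y, a x -> b y -> ltK x y.

(* pr_1(kappa, kappa, theta, chi)_p, with kappa = (K, ltK), theta = |Th|,
   chi = |C|, and p : [kappa]^2 -> M (only its values on pairs x < y matter). *)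
Definition pr1 {K M : Type} (ltK : K -> K -> Prop) (Th C : Type) (p : K -> K -> M) : Prop :=
  exists c : K -> K -> Th,
    forall (S : Type) (ltS : S -> S -> Prop),
      well_order ltS -> inj S C -> ~ inj C S ->
    forall A : (K -> Prop) -> Prop,
      (forall a, A a -> has_otype ltK ltS a) ->
      (forall a b, A a -> A b -> a <> b -> forall x, a x -> b x -> False) ->
      (exists f : K -> (K -> Prop), (forall x y, f x = f y -> x = y) /\
                                   (forall a, A a <-> exists x, f x = a)) ->
    forall tau : M -> Th,
      exists a b, A a /\ A b /\ set_lt ltK a b /\
        (forall x y, a x -> b y -> c x y = tau (p x y)).

(* Main.v *)
From Stdlib Require Import Relations Wellfounded ProofIrrelevance Classical ClassicalEpsilon
  FunctionalExtensionality PropExtensionality List FinFun Lia.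
Require Import Defs.
Import ListNotations.

(* The forward direction: given a colouring c with values in L, read c(x, y) as
   a triple (i, j, k) and let it encode a point of K as follows.  With e(x, .)
   enumerating the predecessors of x, the new colour is e(e(u, j), k), where
   u = psi(i, x, y) is decoded from i and the pair.  All values of tau lie below
   some d, and k only has to name tau in the enumeration of d; j names d in the
   enumeration of u.  So it suffices that, for a and b suitably chosen, psi is
   constant on a x b for some i.

   Here psi(i, x, y) is the least element above x of a set D(i, y) of fewer than
   |L| points.  If all D(i, y), y in b, contain u and their union is bounded
   below u, then psi(i, x, y) = u as soon as x is below u and above that bound;
   and c(x, y) is prescribed on a x b for some a in that interval, because u can
   be taken in a club depending on c and the family.  If L is regular, D(i, y) is
   the i-th initial part of the enumeration of y, and u is any point of the club
   of cofinality |L|.  If L is singular, D(i, y) consists of the points reached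
   from that initial part by descending paths; a club-guessing argument in the
   style of Shelah shows that they include a point of the club of cofinality
   larger than |D(i, y)|. *)

(** * Choice, well-founded recursion and injections between types *)

Lemma dep_choice {A : Type} {B : A -> Type} (R : forall a, B a -> Prop) :
  (forall x, exists y, R x y) -> exists f : forall a, B a, forall x, R x (f x).
Proof.
  intros H.
  exists (fun x => proj1_sig (constructive_indefinite_description _ (H x))).
  intros x. exact (proj2_sig (constructive_indefinite_description _ (H x))).
Qed.

Lemma choice {A B : Type} (R : A -> B -> Prop) :
  (forall x, exists y, R x y) -> exists f, forall x, R x (f x).
Proof. exact (dep_choice R). Qed.

Lemma wf_min {A : Type} (R : A -> A -> Prop) (P : A -> Prop) :
  well_founded R -> (exists x, P x) -> exists x, P x /\ forall y, P y -> ~ R y x.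
Proof.
  intros wf [x Px]. revert Px.
  induction (wf x) as [x _ IH]. intros Px.
  destruct (classic (exists y, P y /\ R y x)) as [[y [Py Ryx]] | no].
  - exact (IH y Ryx Py).
  - exists x. split; [exact Px|]. intros y Py Ryx. apply no. now exists y.
Qed.

Lemma wf_rec {A B : Type} (R : A -> A -> Prop) :
  well_founded R ->
  forall G : forall a, (forall a', R a' a -> B) -> B,
  exists f : A -> B, forall a, f a = G a (fun a' _ => f a').
Proof.
  intros wf G. exists (Fix wf (fun _ => B) G). intros a.
  refine (Fix_eq wf (fun _ => B) G _ a).
  intros x f g Hfg. f_equal.
  extensionality y. extensionality h. apply Hfg.
Qed.

Lemma inj_trans {A B D : Type} : inj A B -> inj B D -> inj A D.
Proof.
  intros [f Hf] [g Hg]. exists (fun x => g (f x)). auto.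
Qed.

Lemma inj_subtype {A B : Type} (P : A -> Prop) (f : A -> B) :
  (forall x y, P x -> P y -> f x = f y -> x = y) -> inj (subtype_of P) B.
Proof.
  intros H. exists (fun s => f (proj1_sig s)).
  intros [x Px] [y Py] E. simpl in E. apply subset_eq_compat. auto.
Qed.

Lemma inj_on {A B : Type} (P : A -> Prop) :
  inhabited B -> inj (subtype_of P) B ->
  exists f : A -> B, forall x y, P x -> P y -> f x = f y -> x = y.
Proof.
  intros [b0] [f Hf].
  destruct (choice (fun x b => forall h : P x, f (exist _ x h) = b)) as [g Hg].
  { intros x. destruct (classic (P x)) as [h | h].
    - exists (f (exist _ x h)). intros h'. now rewrite (proof_irrelevance _ h' h).
    - now exists b0. }
  exists g. intros x y Px Py E. rewrite <- (Hg x Px), <- (Hg y Py) in E.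
  apply Hf in E. now injection E.
Qed.

(** To obtain an injection it is enough to give a relation whose codes determine what they code. *)
Lemma inj_choose {A B : Type} (P : A -> Prop) (R : A -> B -> Prop) :
  (forall x, P x -> exists b, R x b) ->
  (forall x y b, P x -> P y -> R x b -> R y b -> x = y) ->
  inj (subtype_of P) B.
Proof.
  intros ex un.
  destruct (choice (fun (s : subtype_of P) b => R (proj1_sig s) b)) as [f Hf].
  { intros [x Px]. exact (ex x Px). }
  exists f. intros [x Px] [y Py] E. apply subset_eq_compat.
  apply (un x y (f (exist _ x Px))); auto.
  - apply (Hf (exist _ x Px)).
  - rewrite E. apply (Hf (exist _ y Py)).
Qed.

Lemma inj_choose_all {A B : Type} (R : A -> B -> Prop) :
  (forall x, exists b, R x b) -> (forall x y b, R x b -> R y b -> x = y) -> inj A B.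
Proof.
  intros ex un. destruct (choice R ex) as [f Hf].
  exists f. intros x y E. apply (un x y (f x)); auto. rewrite E. auto.
Qed.

Lemma inj_left_inverse {A B : Type} :
  inhabited A -> inj A B -> exists (f : A -> B) (g : B -> A), forall a, g (f a) = a.
Proof.
  intros inh [f Hf]. exists f, (fun b => epsilon inh (fun a => f a = b)).
  intros a. apply Hf. apply (epsilon_spec inh (fun x => f x = f a)). now exists a.
Qed.

(** Recursion along [A], taking at each stage an [R]-minimal value not yet used: either fresh values
    never run out, or a proper segment of [A] exhausts [B]. With [R] empty this compares sizes; with
    [R] an order it enumerates increasingly. *)
Lemma least_fresh_or_covered {A B : Type} (ltA : A -> A -> Prop) (R : B -> B -> Prop) :
  well_founded ltA -> well_founded R -> inhabited B ->
  (exists f : A -> B, forall a, (forall a', ltA a' a -> f a' <> f a) /\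
     forall b, (forall a', ltA a' a -> f a' <> b) -> ~ R b (f a)) \/
  (exists a (f : A -> B), forall b, exists a', ltA a' a /\ f a' = b).
Proof.
  intros wfA wfR inh.
  destruct (wf_rec (B := B) ltA wfA (fun a rec => epsilon inh (fun b =>
    (forall a' h, rec a' h <> b) /\
    forall b', (forall a' h, rec a' h <> b') -> ~ R b' b))) as [f Hf].
  destruct (classic (exists a, forall b, exists a', ltA a' a /\ f a' = b)) as [[a Ha] | no].
  - right. exists a, f. exact Ha.
  - left. exists f. intros a.
    assert (S : exists b, (forall a' (h : ltA a' a), f a' <> b) /\
        forall b', (forall a' (h : ltA a' a), f a' <> b') -> ~ R b' b).
    { apply (wf_min R (fun b => forall a', ltA a' a -> f a' <> b) wfR).
      apply NNPP. intros nb. apply no. exists a. intros b. apply NNPP. intros nb'.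
      apply nb. exists b. intros a' h E. apply nb'. now exists a'. }
    pose proof (epsilon_spec inh _ S) as E.
    pose proof (Hf a) as Ea. cbv beta in Ea. rewrite <- Ea in E. exact E.
Qed.

(** * Well orders and comparability of cardinalities *)

Lemma wo_irr {T} {lt : T -> T -> Prop} : well_order lt -> forall x, ~ lt x x.
Proof. intros W; apply W. Qed.
Lemma wo_trans {T} {lt : T -> T -> Prop} :
  well_order lt -> forall x y z, lt x y -> lt y z -> lt x z.
Proof. intros W; apply W. Qed.
Lemma wo_total {T} {lt : T -> T -> Prop} :
  well_order lt -> forall x y, lt x y \/ x = y \/ lt y x.
Proof. intros W; apply W. Qed.
Lemma wo_wf {T} {lt : T -> T -> Prop} : well_order lt -> well_founded lt.
Proof. intros W; apply W. Qed.

Lemma wo_le_lt {T} {lt : T -> T -> Prop} :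
  well_order lt -> forall x y z, ~ lt y x -> lt y z -> lt x z.
Proof.
  intros W x y z H1 H2. destruct (wo_total W x y) as [H | [-> | H]]; auto; [|easy].
  exact (wo_trans W _ _ _ H H2).
Qed.
Lemma wo_lt_le {T} {lt : T -> T -> Prop} :
  well_order lt -> forall x y z, lt x y -> ~ lt z y -> lt x z.
Proof.
  intros W x y z H1 H2. destruct (wo_total W y z) as [H | [-> | H]]; auto; [|easy].
  exact (wo_trans W _ _ _ H1 H).
Qed.
Lemma wo_le_trans {T} {lt : T -> T -> Prop} :
  well_order lt -> forall x y z, ~ lt y x -> ~ lt z y -> ~ lt z x.
Proof. intros W x y z H1 H2 H. apply H2. exact (wo_lt_le W _ _ _ H H1). Qed.
Lemma wo_lt_asym {T} {lt : T -> T -> Prop} :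
  well_order lt -> forall x y, lt x y -> ~ lt y x.
Proof. intros W x y H1 H2. exact (wo_irr W _ (wo_trans W _ _ _ H1 H2)). Qed.
Lemma wo_antisym {T} {lt : T -> T -> Prop} :
  well_order lt -> forall x y, ~ lt x y -> ~ lt y x -> x = y.
Proof. intros W x y H1 H2. destruct (wo_total W x y) as [H | [H | H]]; easy. Qed.

Lemma inj_or_segment {A : Type} (ltA : A -> A -> Prop) (B : Type) :
  well_order ltA -> inj A B \/ exists a, inj B (segment ltA a).
Proof.
  intros W. destruct (classic (inhabited B)) as [inh | ninh].
  - destruct (least_fresh_or_covered ltA (fun _ _ : B => False) (wo_wf W)) as
      [[f Hf] | [a [f Hf]]]; auto.
    + intros b. constructor. easy.
    + left. exists f. intros x y E.
      destruct (wo_total W x y) as [H | [H | H]]; auto.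
      * now destruct (proj1 (Hf y) x H).
      * now destruct (proj1 (Hf x) y H).
    + right. exists a.
      apply (inj_choose_all (fun b (s : segment ltA a) => f (proj1_sig s) = b)).
      * intros b. destruct (Hf b) as [a' [h E]]. now exists (exist _ a' h).
      * congruence.
  - destruct (classic (inhabited A)) as [[a] | nA].
    + right. exists a. exists (fun b => False_rect _ (ninh (inhabits b))).
      intros b. now destruct (ninh (inhabits b)).
    + left. exists (fun a => False_rect _ (nA (inhabits a))).
      intros a. now destruct (nA (inhabits a)).
Qed.

(** * Finite types, and infinite cardinal arithmetic by way of trees *)

Definition finite_type (T : Type) : Prop := exists l : list T, forall x, In x l.

Lemma finite_or_inj_nat (T : Type) : inj nat T \/ finite_type T.
Proof.
  destruct (classic (inhabited T)) as [inh | ninh].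
  - destruct (least_fresh_or_covered lt (fun _ _ : T => False)
      Wf_nat.lt_wf ltac:(intros b; constructor; easy) inh) as [[f Hf] | [n [f Hf]]].
    + left. exists f. intros x y E.
      destruct (PeanoNat.Nat.lt_trichotomy x y) as [H | [H | H]]; auto.
      * now destruct (proj1 (Hf y) x H).
      * now destruct (proj1 (Hf x) y H).
    + right. exists (map f (seq 0 n)). intros b. destruct (Hf b) as [k [Hk <-]].
      apply in_map. apply in_seq. lia.
  - right. exists []. intros x. now destruct ninh.
Qed.

Lemma finite_not_inj_nat (T : Type) : finite_type T -> ~ inj nat T.
Proof.
  intros [l Hl] [f Hf].
  assert (H : length (map f (seq 0 (S (length l)))) <= length l).
  { apply NoDup_incl_length; [|intros x _; auto].
    apply Injective_map_NoDup; [exact Hf | apply seq_NoDup]. }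
  rewrite length_map, length_seq in H. lia.
Qed.

Lemma finite_option (T : Type) : finite_type T -> finite_type (option T).
Proof.
  intros [l Hl]. exists (None :: map Some l). intros [x|]; simpl; auto.
  right. apply in_map. auto.
Qed.

Lemma finite_prod (A B : Type) : finite_type A -> finite_type B -> finite_type (A * B).
Proof.
  intros [l Hl] [m Hm]. exists (list_prod l m). intros [a b]. apply in_prod; auto.
Qed.

(** One closure that absorbs options, pairs and finite lists, so that a single bound on [tree X]
    replaces separate arithmetic for each. It is infinite even when [X] is empty. *)
Inductive tree (X : Type) : Type :=
| Nil
| Leaf (x : X)
| Node (l r : tree X).
Arguments Nil {X}.
Arguments Leaf {X} x.
Arguments Node {X} l r.

Fixpoint tree_of_list {X : Type} (l : list (tree X)) : tree X :=
  match l with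
  | [] => Nil
  | t :: l => Node t (tree_of_list l)
  end.

Lemma tree_of_list_inj {X : Type} (l m : list (tree X)) :
  tree_of_list l = tree_of_list m -> l = m.
Proof.
  revert m. induction l as [|t l IH]; intros [|u m]; simpl; try easy.
  intros [= -> E]. f_equal. auto.
Qed.

Fixpoint tree_map {X Y : Type} (f : X -> Y) (t : tree X) : tree Y :=
  match t with
  | Nil => Nil
  | Leaf x => Leaf (f x)
  | Node l r => Node (tree_map f l) (tree_map f r)
  end.

Lemma inj_tree_mono {X Y : Type} : inj X Y -> inj (tree X) (tree Y).
Proof.
  intros [f Hf]. exists (tree_map f).
  intros t. induction t as [|x|l IHl r IHr]; intros [|y|l' r']; simpl; try easy.
  - intros [= E]. f_equal. auto.
  - intros [= E1 E2]. f_equal; auto.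
Qed.

Fixpoint tree_code {X : Type} (n : nat -> X) (pair : X * X -> X) (t : tree X) : X :=
  match t with
  | Nil => pair (n 0, n 0)
  | Leaf x => pair (n 1, x)
  | Node l r => pair (n 2, pair (tree_code n pair l, tree_code n pair r))
  end.

Lemma inj_tree (X : Type) : inj nat X -> inj (X * X) X -> inj (tree X) X.
Proof.
  intros [n Hn] [pair Hp]. exists (tree_code n pair).
  intros t. induction t as [|x|l IHl r IHr]; intros [|y|l' r']; simpl; try easy;
    intros E; apply Hp in E; assert (E1 := f_equal fst E); assert (E2 := f_equal snd E);
    simpl in E1, E2; try (apply Hn in E1; discriminate).
  - now subst.
  - apply Hp in E2. injection E2 as E2 E3. f_equal; auto.
Qed.

Definition tree_of_option {X : Type} (o : option X) : tree X :=
  match o with None => Nil | Some x => Leaf x end.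

Lemma inj_option_pair_tree (X : Type) : inj (option X * option X) (tree X).
Proof.
  exists (fun p => Node (tree_of_option (fst p)) (tree_of_option (snd p))).
  intros [[x|] [y|]] [[x'|] [y'|]]; simpl; congruence.
Qed.

Lemma inj_fst {X Y : Type} : inhabited Y -> inj X (X * Y).
Proof. intros [y]. exists (fun x => (x, y)). congruence. Qed.

Lemma inj_prod {A B A' B' : Type} : inj A A' -> inj B B' -> inj (A * B) (A' * B').
Proof.
  intros [f Hf] [g Hg]. exists (fun p => (f (fst p), g (snd p))).
  intros [a b] [a' b'] E. injection E as E1 E2. f_equal; auto.
Qed.

(** An infinite [Z] absorbs the added points and the square through trees; a finite [Z] leaves the
    square finite. *)
Lemma not_inj_option_square (X Z : Type) :
  inj nat X -> (inj nat Z -> inj (tree Z) Z) -> ~ inj X Z ->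
  ~ inj X (option Z * option Z).
Proof.
  intros HX HZ H H'. destruct (finite_or_inj_nat Z) as [HZ' | HZ'].
  - apply H. apply (inj_trans H'). apply (inj_trans (inj_option_pair_tree Z)). auto.
  - apply (finite_not_inj_nat (option Z * option Z)).
    + apply finite_prod; now apply finite_option.
    + exact (inj_trans HX H').
Qed.

Lemma inj_segment_le {T : Type} (lt : T -> T -> Prop) (m : T) (P : T -> Prop) :
  well_order lt -> (forall z, P z -> ~ lt m z) ->
  inj (subtype_of P) (option (segment lt m)).
Proof.
  intros W HP.
  apply (inj_choose P (fun z o => match o with
    | None => z = m | Some s => proj1_sig s = z end)).
  - intros z Pz. destruct (wo_total W z m) as [h | [h | h]].
    + now exists (Some (exist _ z h)).
    + now exists None.
    + now destruct (HP z Pz).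
  - intros x y [s|] _ _; congruence.
Qed.

Lemma inj_segment_mono {T : Type} (lt : T -> T -> Prop) (x y : T) :
  well_order lt -> ~ lt y x -> inj (segment lt x) (segment lt y).
Proof.
  intros W H.
  exists (fun s => exist _ (proj1_sig s) (wo_lt_le W _ _ _ (proj2_sig s) H)).
  intros [a ha] [b hb] E. injection E as E. now apply subset_eq_compat.
Qed.

(* The order on pairs used here (first by maximum, then lexicographically) is
   Goedel's: every proper segment lies in a square of bounded pairs. *)
Lemma segment_square {T : Type} (lt : T -> T -> Prop) :
  well_order lt ->
  forall x, inj nat (segment lt x) -> inj (segment lt x * segment lt x) (segment lt x).
Proof.
  intros W x. induction (wo_wf W x) as [x _ IH]. intros inf.
  (* Either a shorter segment has the same size, and the induction hypothesis transfers, or [x] is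
     an initial ordinal. *)
  destruct (classic (exists y, lt y x /\ inj (segment lt x) (segment lt y)))
    as [[y [yx Hxy]] | init].
  - apply (inj_trans (inj_prod Hxy Hxy)).
    assert (Hyx : inj (segment lt y) (segment lt x)).
    { apply inj_segment_mono; auto. now apply wo_lt_asym. }
    refine (inj_trans (IH y yx _) Hyx). exact (inj_trans inf Hxy).
  - set (X := segment lt x).
    set (mx := fun w : X * X =>
      if excluded_middle_informative (lt (proj1_sig (fst w)) (proj1_sig (snd w)))
      then proj1_sig (snd w) else proj1_sig (fst w)).
    set (lex := slexprod T (T * T) lt (slexprod T T lt lt)).
    set (code := fun w : X * X => (mx w, (proj1_sig (fst w), proj1_sig (snd w)))).
    assert (lexwf : well_founded lex).
    { apply wf_slexprod; [apply (wo_wf W)|]. apply wf_slexprod; apply (wo_wf W). }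
    assert (lextri : forall u v, lex u v \/ u = v \/ lex v u).
    { intros [a [b c]] [a' [b' c']].
      destruct (wo_total W a a') as [h | [-> | h]]; [left; now left | | right; right; now left].
      destruct (wo_total W b b') as [h | [-> | h]];
        [left; right; now left | | right; right; right; now left].
      destruct (wo_total W c c') as [h | [-> | h]];
        [left; right; now right | | right; right; right; now right].
      now right; left. }
    assert (lexfst : forall u v, lex u v -> ~ lt (fst v) (fst u)).
    { intros u v [a a' q q' h | a q q' h]; simpl.
      - now apply wo_lt_asym.
      - now apply wo_irr. }
    assert (codeinj : forall u v, code u = code v -> u = v).
    { intros [[a ha] [b hb]] [[a' ha'] [b' hb']] E. unfold code in E. simpl in E.
      injection E as _ E1 E2. f_equal; now apply subset_eq_compat. }
    destruct (least_fresh_or_covered (A := X * X) (B := X)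
      (fun u v => lex (code u) (code v)) (fun _ _ => False)) as [[f Hf] | [w [f Hf]]].
    + apply wf_inverse_image. exact lexwf.
    + constructor. easy.
    + destruct inf as [g _]. exact (inhabits (g 0)).
    + exists f. intros u v E. destruct (lextri (code u) (code v)) as [h | [h | h]]; auto.
      * now destruct (proj1 (Hf v) u h).
      * now destruct (proj1 (Hf u) v h).
    (* Here the pairs preceding [w] already cover [X], so [X] embeds in the square of the points up
       to [m], which is too small as [x] is initial. *)
    + exfalso. set (m := mx w).
      assert (mlt : lt m x).
      { unfold m, mx. destruct excluded_middle_informative; apply proj2_sig. }
      set (P := fun z => ~ lt m z).
      assert (Hsq : inj X (subtype_of P * subtype_of P)).
      { apply (inj_choose_all (fun b (q : subtype_of P * subtype_of P) => exists w',
          f w' = b /\ proj1_sig (fst q) = proj1_sig (fst w') /\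
          proj1_sig (snd q) = proj1_sig (snd w'))).
        - intros b. destruct (Hf b) as [w' [h E]].
          assert (hm : ~ lt m (mx w')).
          { exact (lexfst _ _ h). }
          assert (h1 : P (proj1_sig (fst w'))).
          { intros h'. apply hm. unfold mx. destruct excluded_middle_informative as [l|l]; auto.
            exact (wo_trans W _ _ _ h' l). }
          assert (h2 : P (proj1_sig (snd w'))).
          { intros h'. apply hm. unfold mx. destruct excluded_middle_informative as [l|l]; auto.
            exact (wo_lt_le W _ _ _ h' l). }
          exists (exist _ _ h1, exist _ _ h2), w'. auto.
        - intros b b' q [w1 [<- [E1 E2]]] [w2 [<- [E3 E4]]]. f_equal.
          destruct w1 as [[? ?] [? ?]], w2 as [[? ?] [? ?]]. simpl in *.
          f_equal; apply subset_eq_compat; congruence. }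
      assert (HP : inj (subtype_of P) (option (segment lt m))).
      { apply inj_segment_le; auto. }
      apply (not_inj_option_square X (segment lt m)); auto.
      * intros infm. apply inj_tree; auto.
      * intros h. apply init. now exists m.
      * exact (inj_trans Hsq (inj_prod HP HP)).
Qed.

Lemma segment_tree {T : Type} (lt : T -> T -> Prop) :
  well_order lt ->
  forall x, inj nat (segment lt x) -> inj (tree (segment lt x)) (segment lt x).
Proof.
  intros W x H. apply inj_tree; auto. now apply segment_square.
Qed.

Lemma segment_well_order {T : Type} (lt : T -> T -> Prop) (x : T) :
  well_order lt -> well_order (fun a b : segment lt x => lt (proj1_sig a) (proj1_sig b)).
Proof.
  intros W. split; [|split; [|split]].
  - intros a. apply (wo_irr W).
  - intros a b d. apply (wo_trans W).
  - intros [a ha] [b hb]. simpl. destruct (wo_total W a b) as [h | [h | h]]; auto.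
    right; left. now apply subset_eq_compat.
  - apply wf_inverse_image. apply (wo_wf W).
Qed.

(** Transfinite recursion in which each new value has to meet a requirement against all earlier
    ones. *)
Lemma chain {Z V : Type} (ltV : V -> V -> Prop) (Q : Z -> Prop) (R : Z -> Z -> Prop) :
  well_founded ltV ->
  (forall v (g : segment ltV v -> Z), exists z, Q z /\ forall s, R (g s) z) ->
  exists f : V -> Z, forall v, Q (f v) /\ forall w, ltV w v -> R (f w) (f v).
Proof.
  intros wf H.
  destruct (wf_rec ltV wf (fun v rec => proj1_sig (constructive_indefinite_description _
    (H v (fun s => rec (proj1_sig s) (proj2_sig s)))))) as [f Hf].
  exists f. intros v. rewrite (Hf v).
  destruct constructive_indefinite_description as [z [Qz Rz]]. simpl.
  split; [exact Qz|]. intros w h. exact (Rz (exist _ w h)).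
Qed.

(** * Bounded sets, clubs and cofinality in the successor cardinal *)

Section Successor.

Context {L : Type} {ltL : L -> L -> Prop} {K : Type} {ltK : K -> K -> Prop}.
Context (HL : infinite_cardinal ltL) (HK : successor_of L ltK).

Let WL : well_order ltL := proj1 HL.
Let WK : well_order ltK := proj1 HK.

Lemma inj_nat_L : inj nat L.
Proof. apply HL. Qed.

Lemma inj_segK (x : K) : inj (segment ltK x) L.
Proof. apply HK. Qed.

Lemma inj_L_segK : exists x : K, inj L (segment ltK x).
Proof.
  destruct (inj_or_segment ltK L WK) as [H | H]; auto. now destruct (proj2 (proj2 HK) H).
Qed.

(** [L] embeds in a segment of [K], which embeds back in [L]; so the arithmetic of segments passes
    to [L]. *)
Lemma inj_tree_L : inj (tree L) L.
Proof.
  destruct inj_L_segK as [x Hx].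
  apply (inj_trans (inj_tree_mono Hx)).
  refine (inj_trans _ (inj_segK x)).
  apply segment_tree; [exact WK|]. exact (inj_trans inj_nat_L Hx).
Qed.

Lemma inj_prod_L {A B : Type} : inj A L -> inj B L -> inj (A * B) L.
Proof.
  intros [f Hf] [g Hg]. refine (inj_trans _ inj_tree_L).
  exists (fun q => Node (Leaf (f (fst q))) (Leaf (g (snd q)))).
  intros [a b] [a' b'] E. injection E as E1 E2. f_equal; auto.
Qed.

Lemma inj_L_K : inj L K.
Proof.
  destruct inj_L_segK as [x Hx]. apply (inj_trans Hx).
  exists (@proj1_sig _ _). intros [a ha] [b hb]. simpl. intros. now apply subset_eq_compat.
Qed.

Lemma inhabited_L : inhabited L.
Proof. destruct inj_nat_L as [f _]. exact (inhabits (f 0)). Qed.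

Lemma inhabited_K : inhabited K.
Proof. destruct inj_L_segK as [x _]. exact (inhabits x). Qed.

(** [e x] lists the predecessors of [x] with indices in [L], and [r y x] is the index of [y] in that
    list. *)
Lemma enumerations :
  exists (r : K -> K -> L) (e : K -> L -> K), forall x y, ltK y x -> e x (r y x) = y.
Proof.
  destruct (choice (fun x (q : (K -> L) * (L -> K)) =>
    forall y, ltK y x -> snd q (fst q y) = y)) as [q Hq].
  - intros x. destruct (inj_on _ inhabited_L (inj_segK x)) as [r Hr].
    destruct (choice (fun l y => forall y', ltK y' x -> r y' = l -> y' = y)) as [e He].
    { intros l. destruct (classic (exists y, ltK y x /\ r y = l)) as [[y [h E]] | no].
      - exists y. intros y' h' E'. apply Hr; congruence.
      - destruct inhabited_K as [y]. exists y. intros y' h E. destruct no. now exists y'. }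
    exists (r, e). simpl. intros y h. symmetry. now apply He.
  - exists (fun y x => fst (q x) y), (fun x => snd (q x)). exact Hq.
Qed.

Lemma inj_leK (N : K) (P : K -> Prop) : (forall z, P z -> ~ ltK N z) -> inj (subtype_of P) L.
Proof.
  intros HP. apply (inj_trans (inj_segment_le ltK N P WK HP)).
  refine (inj_trans _ inj_tree_L).
  destruct (inj_segK N) as [f Hf].
  exists (fun o => match o with None => Nil | Some s => Leaf (f s) end).
  intros [x|] [y|] E; try easy. injection E as E. f_equal. auto.
Qed.

(** Regularity of a successor: if [g] were unbounded, each [N] would be coded by some [i] with [g i]
    at or above [N], together with the index of [N] among the points up to [g i]. *)
Lemma bounded {I : Type} (g : I -> K) : inj I L -> exists N, forall i, ltK (g i) N.
Proof.
  intros HI. apply NNPP. intros no. apply HK.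
  assert (H : forall N, exists i, ~ ltK (g i) N).
  { intros N. apply NNPP. intros n. apply no. exists N. intros i. apply NNPP.
    intros n'. apply n. now exists i. }
  destruct (choice (fun x (f : K -> L) => forall a b, ~ ltK x a -> ~ ltK x b ->
    f a = f b -> a = b)) as [f Hf].
  { intros x. exact (inj_on _ inhabited_L (inj_leK x _ (fun z h => h))). }
  refine (inj_trans _ (inj_prod_L HI (ex_intro _ (fun x : L => x) (fun _ _ E => E)))).
  apply (inj_choose_all (fun N (q : I * L) =>
    ~ ltK (g (fst q)) N /\ f (g (fst q)) N = snd q)).
  - intros N. destruct (H N) as [i h]. now exists (i, f (g i) N).
  - intros x y q [h E] [h' E']. apply (Hf (g (fst q))); congruence.
Qed.

Lemma above (x y : K) : exists z, ltK x z /\ ltK y z.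
Proof.
  destruct (bounded (fun b : bool => if b then x else y)) as [N HN].
  - refine (inj_trans _ inj_nat_L).
    exists (fun b : bool => if b then 0 else 1). now intros [] [].
  - exists N. split; [exact (HN true) | exact (HN false)].
Qed.

Lemma increasing_sequence {V : Type} (ltV : V -> V -> Prop) (T : K -> K) (x0 : K) :
  well_founded ltV -> (forall v, inj (segment ltV v) L) ->
  exists f : V -> K, forall v, ltK x0 (f v) /\
    forall w, ltV w v -> ltK (f w) (f v) /\ ltK (T (f w)) (f v).
Proof.
  intros wf HV.
  apply (chain ltV (fun z => ltK x0 z) (fun y z => ltK y z /\ ltK (T y) z) wf).
  intros v g.
  destruct (bounded g (HV v)) as [N1 H1].
  destruct (bounded (fun s => T (g s)) (HV v)) as [N2 H2].
  destruct (above N1 N2) as [N3 [H13 H23]]. destruct (above x0 N3) as [N [H0 H3]].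
  exists N. split; [exact H0|]. intros s. split.
  - exact (wo_trans WK _ _ _ (H1 s) (wo_trans WK _ _ _ H13 H3)).
  - exact (wo_trans WK _ _ _ (H2 s) (wo_trans WK _ _ _ H23 H3)).
Qed.

(** Clubs are represented by functions: the points closed under [N] form a club, and a pointwise
    larger function gives a smaller club. *)
Definition closed_under (N : K -> K) (x : K) : Prop := forall y, ltK y x -> ~ ltK x (N y).

Definition cof_gt (Y : Type) {T : Type} (lt : T -> T -> Prop) : Prop :=
  forall P : T -> Prop, inj (subtype_of P) Y -> exists v, forall w, P w -> lt w v.

(** The cofinality of [x] exceeds the size of [Y], except that the bound [z] is not strict, so
    successor points qualify for every [Y]. *)
Definition cof_gt_at (Y : Type) (x : K) : Prop :=
  forall P : K -> Prop, (forall y, P y -> ltK y x) -> inj (subtype_of P) Y ->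
    exists z, ltK z x /\ forall y, P y -> ~ ltK z y.

(** The supremum of a [V]-sequence of closing-off steps is closed under [N] and inherits the
    cofinality of [V]. *)
Lemma closed_point {V : Type} (ltV : V -> V -> Prop) (N : K -> K) :
  well_order ltV -> inj V L -> inhabited V -> (forall v, exists w, ltV v w) ->
  exists x, closed_under N x /\ forall Y, cof_gt Y ltV -> cof_gt_at Y x.
Proof.
  intros WV VL [v0] nomax. destruct inhabited_K as [k0].
  (* [N] need not be monotone, so [T z] bounds it on all points up to [z]. *)
  destruct (choice (fun z t => forall z', ~ ltK z z' -> ltK (N z') t)) as [T HT].
  { intros z. destruct (bounded (fun s : subtype_of (fun z' => ~ ltK z z') =>
      N (proj1_sig s)) (inj_leK z _ (fun _ h => h))) as [t Ht].
    exists t. intros z' h. exact (Ht (exist _ z' h)). }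
  destruct (increasing_sequence ltV T k0 (wo_wf WV)) as [f Hf].
  { intros v. refine (inj_trans _ VL).
    exists (@proj1_sig _ _). intros [a ha] [b hb]. simpl. intros. now apply subset_eq_compat. }
  destruct (wf_min ltK (fun x => forall v, ltK (f v) x) (wo_wf WK)) as [x [fx xmin]].
  { exact (bounded f VL). }
  assert (below : forall y, ltK y x -> exists v, ~ ltK (f v) y).
  { intros y h. apply NNPP. intros no. apply (xmin y); [|exact h].
    intros v. apply NNPP. intros n. apply no. now exists v. }
  exists x. split.
  - intros y h. destruct (below y h) as [v Hv]. destruct (nomax v) as [w Hw].
    apply (wo_lt_asym WK). apply (wo_trans WK _ _ _ (HT _ _ Hv)).
    apply (wo_trans WK _ (f w)); auto. now apply Hf.
  - intros Y HY P Px PY.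
    destruct (choice (fun y v => ltK y x -> ~ ltK (f v) y)) as [g Hg].
    { intros y. destruct (classic (ltK y x)) as [h | h].
      - destruct (below y h) as [v Hv]. now exists v.
      - now exists v0. }
    destruct (HY (fun v => exists y, P y /\ g y = v)) as [v Hv].
    { refine (inj_trans _ PY). apply (inj_choose _
        (fun v (s : subtype_of P) => g (proj1_sig s) = v)).
      - intros v [y [Py E]]. now exists (exist _ y Py).
      - congruence. }
    exists (f v). split; auto. intros y Py h.
    apply (Hg y (Px y Py)). apply (wo_trans WK _ (f v)); auto.
    apply Hf. apply Hv. now exists y.
Qed.

(** * Disjoint families of small subsets of [K] *)

Section Families.

Context {S : Type} {ltS : S -> S -> Prop}.
Context (SL : inj S L).

Definition disjoint_family (A : (K -> Prop) -> Prop) : Prop :=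
  (forall a, A a -> has_otype ltK ltS a) /\
  (forall a b, A a -> A b -> a <> b -> forall x, a x -> b x -> False) /\
  (exists f : K -> (K -> Prop), (forall x y, f x = f y -> x = y) /\
     (forall a, A a <-> exists x, f x = a)).

(** For empty [S] the only possible member is the empty set, too few for a family indexed
    injectively by [K]. *)
Lemma family_nonempty (A : (K -> Prop) -> Prop) :
  disjoint_family A -> forall a, A a -> exists x, a x.
Proof.
  intros [ot [_ [f [finj fA]]]].
  destruct (classic (inhabited S)) as [[s] | nS].
  - intros a Aa. destruct (ot a Aa) as [g [_ Hg]]. exists (g s). apply Hg. now exists s.
  - exfalso. apply HK. destruct inhabited_L as [l]. exists (fun _ => l).
    intros x y _. apply finj.
    assert (E : forall z, f z = fun _ => False).
    { intros z. extensionality k. apply propositional_extensionality. split; [|easy].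
      intros h. destruct (ot (f z)) as [g [_ Hg]]; [apply fA; now exists z|].
      apply Hg in h. destruct h as [s _]. now destruct nS. }
    now rewrite !E.
Qed.

(** By disjointness, members meeting the points up to [N] are told apart by such a point, so there
    are at most |L| of them. *)
Lemma family_above (A : (K -> Prop) -> Prop) (N : K) :
  disjoint_family A -> exists b, A b /\ forall y, b y -> ltK N y.
Proof.
  intros [_ [dis [f [finj fA]]]]. apply NNPP. intros no. apply HK.
  apply (inj_trans (B := subtype_of (fun z => ~ ltK N z))).
  - apply (inj_choose_all (fun x (s : subtype_of _) => f x (proj1_sig s))).
    + intros x. apply NNPP. intros n. apply no. exists (f x).
      split; [apply fA; now exists x|]. intros y fy. apply NNPP. intros ny. apply n.
      now exists (exist _ y ny).
    + intros x y s h1 h2. apply NNPP. intros ne.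
      apply (dis (f x) (f y)) with (proj1_sig s); auto; apply fA; eauto.
  - now apply inj_leK with N.
Qed.

Lemma family_bounded (A : (K -> Prop) -> Prop) (a : K -> Prop) :
  disjoint_family A -> A a -> exists t, forall x, a x -> ltK x t.
Proof.
  intros [ot _] Aa. destruct (ot a Aa) as [g [_ Hg]].
  destruct (bounded g SL) as [t Ht]. exists t. intros x ax.
  apply Hg in ax. destruct ax as [s <-]. auto.
Qed.

(* Otherwise counterexamples for larger and larger N, chosen by recursion on
   K, would form a subfamily defeating the colouring. *)
Lemma capture {M Th : Type} (c : K -> K -> Th) (p : K -> K -> M) (h : M -> Th) :
  (forall A, disjoint_family A -> exists a b, A a /\ A b /\ set_lt ltK a b /\
     (forall x y, a x -> b y -> c x y = h (p x y))) ->
  forall A, disjoint_family A -> forall z, exists N, forall b, A b ->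
    (forall y, b y -> ltK N y) ->
    exists a, A a /\ (forall x, a x -> ltK z x /\ ltK x N) /\
      (forall x y, a x -> b y -> c x y = h (p x y)).
Proof.
  intros Hc A HA z. apply NNPP. intros no.
  destruct (choice (fun N b => A b /\ (forall y, b y -> ltK N y) /\
    ~ exists a, A a /\ (forall x, a x -> ltK z x /\ ltK x N) /\
      (forall x y, a x -> b y -> c x y = h (p x y)))) as [B HB].
  { intros N. apply NNPP. intros n. apply no. exists N. intros b Ab bN.
    apply NNPP. intros n'. apply n. now exists b. }
  destruct (choice (fun N t => forall x, B N x -> ltK x t)) as [T HT].
  { intros N. apply (family_bounded A); auto. apply HB. }
  (* Jumping past [T] makes the sets [B (f v)] consecutive blocks, hence distinct and pairwise
     ordered. *)
  destruct (increasing_sequence ltK T z (wo_wf WK) inj_segK) as [f Hf].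
  assert (ord : forall v w, ltK v w -> forall x y, B (f v) x -> B (f w) y ->
    ltK x (f w) /\ ltK (f w) y).
  { intros v w vw x y Bx By. split.
    - apply (wo_trans WK _ (T (f v))); auto. now apply Hf.
    - now apply HB. }
  assert (BA : forall v, A (B v)) by (intros; apply HB).
  pose proof (family_nonempty A HA) as ne.
  destruct (Hc (fun a => exists v, B (f v) = a)) as [a [b [[v <-] [[w <-] [ab cab]]]]].
  - repeat split.
    + intros a [v <-]. apply HA. auto.
    + intros a b [v <-] [w <-]. apply HA; auto.
    + exists (fun v => B (f v)). split; [|easy].
      intros v w E.
      assert (asym : forall v w, B (f v) = B (f w) -> ~ ltK v w).
      { intros v' w' E' vw. destruct (ne (B (f v')) (BA _)) as [x Bx].
        assert (Bx' : B (f w') x) by now rewrite <- E'.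
        destruct (ord _ _ vw _ _ Bx Bx') as [h1 h2].
        exact (wo_lt_asym WK _ _ h1 h2). }
      apply (wo_antisym WK); auto.
  - destruct (ne (B (f v)) (BA _)) as [x Bx]. destruct (ne (B (f w)) (BA _)) as [y By].
    destruct (wo_total WK v w) as [vw | [<- | wv]].
    + destruct (HB (f w)) as [_ [_ n]]. apply n. exists (B (f v)).
      split; [auto|]. split; [|exact cab].
      intros x' Bx'. split.
      * apply (wo_trans WK _ (f v)); [apply Hf | now apply HB].
      * now apply (ord _ _ vw x' y).
    + apply (wo_irr WK x). now apply ab.
    + destruct (ord _ _ wv _ _ By Bx) as [h1 h2].
      apply (wo_lt_asym WK x y); [now apply ab|]. exact (wo_trans WK _ _ _ h1 h2).
Qed.

End Families.

(* A set b of fewer than C many points is the range of g : S -> K.  The sets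
   D i y for y in b all contain the closed point x and are bounded below x by
   a common z, so for every t between z and x the least element of D i y above
   t is x: this is how i, t and y determine x. *)
Definition guessing (C : Type) (D : L -> K -> K -> Prop) : Prop :=
  forall N : K -> K, exists N1, forall (S : Type) (g : S -> K),
    inj S C -> ~ inj C S -> (forall s, ltK N1 (g s)) ->
    exists i x z, closed_under N x /\ ltK z x /\
      forall s, ltK x (g s) /\ D i (g s) x /\ forall y, D i (g s) y -> ltK y x -> ~ ltK z y.

(** * Passing between colourings with values in [L] and in [K] *)

Lemma pr1_pump (C : Type) (D : L -> K -> K -> Prop) (p : K -> K -> L) :
  inj C L -> guessing C D -> pr1 ltK L C p -> pr1 ltK K C p.
Proof.
  intros CL HD [c Hc].
  destruct enumerations as [r [e He]].
  destruct (inj_left_inverse (A := L * L * L) (B := L)) as [code [dec Hdec]].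
  { destruct inhabited_L as [l]. exact (inhabits (l, l, l)). }
  { pose proof (ex_intro _ (fun x : L => x) (fun _ _ E => E) : inj L L) as LL.
    now repeat apply inj_prod_L. }
  (* [psi (i, t, y)] is the least element of [D i y] not below [t], and arbitrary if there is
     none. *)
  destruct (choice (fun (q : L * K * K) x => let '(i, t, y) := q in
    (exists x', D i y x' /\ ~ ltK x' t) ->
    (D i y x /\ ~ ltK x t) /\ forall x', D i y x' /\ ~ ltK x' t -> ~ ltK x' x))
    as [psi Hpsi].
  { intros [[i t] y].
    destruct (classic (exists x', D i y x' /\ ~ ltK x' t)) as [H | H].
    - destruct (wf_min ltK _ (wo_wf WK) H) as [x Hx]. now exists x.
    - destruct inhabited_K as [k]. now exists k. }
  exists (fun t y => let '(i, j, k) := dec (c t y) in e (e (psi (i, t, y)) j) k).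
  intros S ltS WS SC CS A ot dis bij tau.
  assert (SL : inj S L) by exact (inj_trans SC CL).
  assert (HA : disjoint_family (ltS := ltS) A) by now repeat split.
  destruct (bounded tau) as [d Hd]; [now exists (fun x => x)|].
  destruct (choice (fun (q : L * L * K) N => let '(i, j, z) := q in forall b, A b ->
    (forall y, b y -> ltK N y) ->
    exists a, A a /\ (forall x, a x -> ltK z x /\ ltK x N) /\
      (forall x y, a x -> b y -> c x y = code (i, j, r (tau (p x y)) d)))) as [Nf HNf].
  { intros [[i j] z].
    apply (capture (ltS := ltS) SL c p (fun l => code (i, j, r (tau l) d))); auto.
    intros A' [ot' [dis' bij']].
    exact (Hc S ltS WS SC CS A' ot' dis' bij' (fun l => code (i, j, r (tau l) d))). }
  (* [N z] dominates [d] and the capture thresholds for all [i] and [j], so a point closed under [N]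
     and above [z] is at or above [N z], hence above all of them. *)
  destruct (choice (fun z N => ltK d N /\ forall i j, ltK (Nf (i, j, z)) N)) as [N HN].
  { intros z. destruct (bounded (fun q : L * L => Nf (q, z))) as [N0 HN0].
    - apply inj_prod_L; now exists (fun x => x).
    - destruct (above d N0) as [N [h1 h2]]. exists N. split; auto.
      intros i j. exact (wo_trans WK _ _ _ (HN0 (i, j)) h2). }
  destruct (HD N) as [N1 HN1].
  destruct (family_above A N1 HA) as [b [Ab bN1]].
  destruct (ot b Ab) as [g [_ Hg]].
  destruct (HN1 S g SC CS) as [i [x [z [Nx [zx Hx]]]]].
  { intros s. apply bN1. apply Hg. now exists s. }
  assert (dx : ltK d x).
  { apply (wo_lt_le WK _ (N z)); [apply HN | now apply Nx]. }
  assert (Nfx : forall j, ltK (Nf (i, j, z)) x).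
  { intros j. apply (wo_lt_le WK _ (N z)); [apply HN | now apply Nx]. }
  (* The middle index [r d x] is known only once [x] is; this is why [N] had to be uniform in
     [j]. *)
  pose proof (HNf (i, r d x, z) b Ab) as Hcap. cbv beta iota in Hcap.
  destruct Hcap as [a [Aa [az cab]]].
  { intros y By. apply Hg in By. destruct By as [s <-].
    apply (wo_trans WK _ x); auto. now apply Hx. }
  assert (ax : forall t, a t -> ltK t x).
  { intros t At. apply (wo_trans WK _ (Nf (i, r d x, z))); auto. now apply az. }
  exists a, b. repeat split; auto.
  - intros t y At By. apply Hg in By. destruct By as [s <-].
    apply (wo_trans WK _ x); auto. now apply Hx.
  - intros t y At By. rewrite (cab t y At By), Hdec.
    apply Hg in By. destruct By as [s <-]. destruct (Hx s) as [xs [Dx Dz]].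
    pose proof (Hpsi (i, t, g s)) as Hp. cbv beta iota in Hp.
    destruct Hp as [[Dp tp] minp].
    { exists x. split; auto. apply (wo_lt_asym WK). auto. }
    (* An element of [D i (g s)] below [x] is at most [z], hence below [t]. *)
    assert (E : psi (i, t, g s) = x).
    { destruct (wo_total WK (psi (i, t, g s)) x) as [h | [h | h]]; auto.
      - exfalso. apply (Dz _ Dp h). apply (wo_lt_le WK _ t); auto. now apply az.
      - exfalso. refine (minp x _ h). split; auto. apply (wo_lt_asym WK). auto. }
    rewrite E, (He x d dx). now apply He.
Qed.

Lemma pr1_restrict (C : Type) {M : Type} (p : K -> K -> M) :
  pr1 ltK K C p -> pr1 ltK L C p.
Proof.
  intros [c Hc].
  destruct (inj_left_inverse inhabited_L inj_L_K) as [f [g fg]].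
  exists (fun x y => g (c x y)).
  intros S ltS WS SC CS A ot dis bij tau.
  destruct (Hc S ltS WS SC CS A ot dis bij (fun m => f (tau m)))
    as [a [b [Aa [Ab [ab cab]]]]].
  exists a, b. repeat split; auto. intros x y ax By. rewrite (cab x y ax By). apply fg.
Qed.

(** * Cofinality of [L], and guessing for regular [L] *)

Lemma no_max (v : L) : exists w, ltL v w.
Proof.
  apply NNPP. intros no.
  (* With [v] maximal, [L] would be a proper segment plus one point. *)
  apply (not_inj_option_square L (segment ltL v) inj_nat_L).
  - apply segment_tree. exact WL.
  - apply HL.
  - refine (inj_trans _ (inj_fst (inhabits None))).
    apply (@inj_trans _ (subtype_of (fun _ : L => True))).
    + exists (fun x => exist _ x I). congruence.
    + apply inj_segment_le; [exact WL|]. intros z _ h. apply no. now exists z.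
Qed.

Lemma list_bounded (l : list L) : exists v, forall w, In w l -> ltL w v.
Proof.
  induction l as [|x l [v Hv]].
  - destruct inhabited_L as [v]. now exists v.
  - destruct (wo_total WL x v) as [h | h].
    + exists v. intros w [<- | Hw]; auto.
    + destruct (no_max x) as [y Hy]. exists y. intros w [<- | Hw]; auto.
      apply (wo_lt_le WL _ v); auto. apply (wo_lt_asym WL).
      destruct h as [-> | h]; auto. exact (wo_trans WL _ _ _ h Hy).
Qed.

Lemma small_bounded {C S : Type} (g : S -> L) :
  le_cf C ltL -> ~ inj C S -> exists i, forall s, ltL (g s) i.
Proof.
  intros HC CS. apply NNPP. intros no. apply CS.
  apply (inj_trans (HC (fun x => exists s, g s = x) ltac:(
    intros x; apply NNPP; intros n; apply no; exists x; intros s; apply NNPP; intros n';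
    apply n; exists (g s); split; [now exists s | exact n']))).
  apply (inj_choose _ (fun x s => g s = x)); auto. congruence.
Qed.

Lemma le_cf_inj {C : Type} : le_cf C ltL -> inj C L.
Proof.
  intros HC. apply (inj_trans (HC (fun _ => True) (fun x =>
    ex_intro _ x (conj I (wo_irr WL x))))).
  now apply (inj_subtype _ (fun x => x)).
Qed.

(** As [S] is smaller than cf([L]), neither the range of [g] nor an embedded copy of [S] is cofinal
    in [L]. *)
Lemma small_segment {C S : Type} (g : S -> L) :
  le_cf C ltL -> inj S C -> ~ inj C S ->
  exists j, forall i, ~ ltL i j -> (forall s, ltL (g s) i) /\ inj S (segment ltL i).
Proof.
  intros HC SC CS.
  destruct (inj_trans SC (le_cf_inj HC)) as [f Hf].
  destruct (small_bounded g HC CS) as [j1 H1].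
  destruct (small_bounded f HC CS) as [j2 H2].
  destruct (list_bounded [j1; j2]) as [j Hj]. exists j. intros i ij.
  assert (le1 : forall s, ltL (g s) i).
  { intros s. apply (wo_lt_le WL _ j); auto. apply (wo_trans WL _ j1); simpl in *; auto. }
  assert (le2 : forall s, ltL (f s) i).
  { intros s. apply (wo_lt_le WL _ j); auto. apply (wo_trans WL _ j2); simpl in *; auto. }
  split; auto. exists (fun s => exist _ (f s) (le2 s)).
  intros s t E. injection E as E. auto.
Qed.

Lemma cof_gt_at_range {Y I : Type} (F : I -> K) (x : K) :
  cof_gt_at Y x -> inj I Y ->
  exists z, ltK z x /\ forall a, ltK (F a) x -> ~ ltK z (F a).
Proof.
  intros Hx IY. destruct (Hx (fun y => ltK y x /\ exists a, F a = y)) as [z [zx Hz]].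
  - now intros y [h _].
  - refine (inj_trans _ IY). apply (inj_choose _ (fun y a => F a = y)).
    + now intros y [_ h].
    + congruence.
  - exists z. split; auto. intros a h. apply Hz. eauto.
Qed.

Lemma guessing_regular (C : Type) :
  le_cf C ltL -> (forall i, cof_gt (segment ltL i * segment ltL i) ltL) ->
  exists D, guessing C D.
Proof.
  intros HC reg. destruct enumerations as [r [e He]].
  exists (fun i y x => exists l, ltL l i /\ x = e y l). intros N.
  (* A sequence of type [L] gives [x] the cofinality of [L]; this one [x] serves every set above
     it. *)
  destruct (closed_point ltL N WL) as [x [Nx Hx]].
  { now exists (fun v => v). }
  { exact inhabited_L. }
  { exact no_max. }
  exists x. intros S g SC CS gx.
  (* [i] exceeds the index of [x] in the enumeration of each [g s]. *)
  destruct (small_segment (fun s => r x (g s)) HC SC CS) as [i Hi].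
  destruct (Hi i (wo_irr WL i)) as [ri Si].
  destruct (cof_gt_at_range (Y := segment ltL i * segment ltL i)
    (fun q : S * segment ltL i => e (g (fst q)) (proj1_sig (snd q))) x) as [z [zx Hz]].
  { apply Hx, reg. }
  { apply inj_prod; [exact Si|]. now exists (fun v => v). }
  exists i, x, z. split; [exact Nx|]. split; [exact zx|]. intros s. split; [auto|]. split.
  - exists (r x (g s)). split; auto. symmetry. auto.
  - intros y [l [li ->]] h. exact (Hz (s, exist _ l li) h).
Qed.

(** * Ladders and descending paths *)

Lemma tree_closed_point (i : L) (N : K -> K) :
  ~ inj L (tree (segment ltL i)) ->
  exists x, closed_under N x /\ cof_gt_at (tree (segment ltL i)) x.
Proof.
  set (Y := tree (segment ltL i)). intros LY.
  (* The segment below the least such [x] has order type |Y|^+, a regular cardinal. *)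
  destruct (wf_min ltK (fun x => ~ inj (segment ltK x) Y) (wo_wf WK)) as [x [xY xmin]].
  { destruct inj_L_segK as [x Hx]. exists x. intros h. exact (LY (inj_trans Hx h)). }
  set (V := segment ltK x).
  set (ltV := fun a b : V => ltK (proj1_sig a) (proj1_sig b)).
  assert (WV : well_order ltV) by now apply segment_well_order.
  assert (HV : cof_gt Y ltV).
  { intros P PY. apply NNPP. intros no. apply xY.
    assert (H : forall v, exists w, P w /\ ~ ltV w v).
    { intros v. apply NNPP. intros n. apply no. exists v. intros w Pw. apply NNPP.
      intros n'. apply n. now exists w. }
    destruct (inj_on P (inhabits Nil) PY) as [f Hf].
    destruct (choice (fun (w : V) (q : K -> Y) => forall a b, ltK a (proj1_sig w) ->
      ltK b (proj1_sig w) -> q a = q b -> a = b)) as [q Hq].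
    { intros w. apply inj_on; [exact (inhabits Nil)|]. apply NNPP. intros n.
      exact (xmin _ n (proj2_sig w)). }
    (* Code [v] by some [w] in [P] at or above it, and by the index of [v] below [w]. *)
    apply (inj_choose_all (fun v t => exists w, P w /\
      (v = w /\ t = Node (f w) Nil \/
       ltV v w /\ t = Node (f w) (Node Nil (q w (proj1_sig v)))))).
    - intros v. destruct (H v) as [w [Pw vw]].
      destruct (wo_total WV v w) as [h | [h | h]]; [ | | easy]; eauto 8.
    - intros v v' t [w [Pw E]] [w' [Pw' E']].
      assert (w = w') as <-.
      { apply Hf; auto. destruct E as [[_ E] | [_ E]], E' as [[_ E'] | [_ E']]; congruence. }
      destruct E as [[E1 E] | [E1 E]], E' as [[E1' E'] | [E1' E']]; try congruence.
      rewrite E in E'. injection E' as E'.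
      destruct v as [v hv], v' as [v' hv']. apply subset_eq_compat.
      exact (Hq w v v' E1 E1' E'). }
  destruct (closed_point ltV N WV) as [y [Ny Hy]].
  - apply inj_segK.
  - apply NNPP. intros n. apply xY. exists (fun _ => Nil). intros v.
    destruct (n (inhabits v)).
  - intros v. destruct (HV (fun w => w = v)) as [w Hw].
    + exists (fun _ => Nil). intros [a ->] [b ->] _. reflexivity.
    + exists w. auto.
  - exists y. auto.
Qed.

(** Enumerate each fibre of [t] increasingly: if every enumeration stopped at a finite stage, [L]
    would embed in [T * nat]. *)
Lemma increasing_in_fiber {T : Type} (t : L -> T) :
  ~ inj L (T * nat) ->
  exists v : nat -> L, (forall n m, n < m -> ltL (v n) (v m)) /\
    exists i, forall n, t (v n) = i.
Proof.
  intros LT. apply NNPP. intros no. apply LT.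
  assert (H : forall i, exists q : L -> nat, forall v w, t v = i -> t w = i ->
    q v = q w -> v = w).
  { intros i. apply inj_on; [exact (inhabits 0)|].
    set (F := subtype_of (fun v => t v = i)).
    destruct (classic (inhabited F)) as [inh | ninh].
    - destruct (least_fresh_or_covered lt
        (fun a b : F => ltL (proj1_sig a) (proj1_sig b)) Wf_nat.lt_wf
        (wf_inverse_image _ _ _ _ (wo_wf WL)) inh) as [[f Hf] | [n [f Hf]]].
      + destruct no. exists (fun n => proj1_sig (f n)). split.
        * intros n m nm. destruct (wo_total WL (proj1_sig (f n)) (proj1_sig (f m)))
            as [h | [h | h]]; auto; exfalso.
          -- apply (proj1 (Hf m) n nm).
             destruct (f n), (f m). now apply subset_eq_compat.
          -- refine (proj2 (Hf n) (f m) _ h). intros k kn. apply (Hf m). lia.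
        * exists i. intros n. exact (proj2_sig (f n)).
      + apply (inj_choose_all (fun b k => f k = b)).
        * intros b. destruct (Hf b) as [k [_ E]]. eauto.
        * congruence.
    - exists (fun _ => 0). intros a. destruct (ninh (inhabits a)). }
  destruct (choice _ H) as [q Hq].
  exists (fun v => (t v, q (t v) v)). intros v w E. injection E as E1 E2.
  apply (Hq (t v)); congruence.
Qed.

(** Alternates dropping to [top] with stepping down a ladder, so a finite list of indices names a
    point reached from [x]. *)
Fixpoint path {Y : Type} (top : K -> K) (lad : K -> Y -> K) (t : list Y) (x : K) : K :=
  match t with
  | [] => top x
  | u :: t => path top lad t (lad (top x) u)
  end.

(** The supremum of the part of [B] at or below [x]. *)
Definition is_lub (B : K -> Prop) (x y : K) : Prop :=
  (forall z, B z -> ~ ltK x z -> ~ ltK y z) /\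
  (forall y', (forall z, B z -> ~ ltK x z -> ~ ltK y' z) -> ~ ltK y' y).

(** Cofinal below [y] when the cofinality of [y] is at most |Y|. The value [y] is allowed as a
    default for spare indices. *)
Definition is_ladder {Y : Type} (y : K) (lad : Y -> K) : Prop :=
  (forall u, ~ ltK y (lad u)) /\
  (~ cof_gt_at Y y -> forall z, ltK z y -> exists u, ltK z (lad u) /\ ltK (lad u) y).

Lemma ladder_exists {Y : Type} (y : K) : exists lad : Y -> K, is_ladder y lad.
Proof.
  destruct (classic (cof_gt_at Y y)) as [h | h].
  - exists (fun _ => y). split; [|easy]. intros _. apply (wo_irr WK).
  - assert (H : exists P : K -> Prop, (forall z, P z -> ltK z y) /\ inj (subtype_of P) Y /\
      forall z, ltK z y -> exists z', P z' /\ ltK z z').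
    { apply NNPP. intros no. apply h. intros P Py PY. apply NNPP. intros n. apply no.
      exists P. split; auto. split; auto. intros z zy. apply NNPP. intros n'. apply n.
      exists z. split; auto. intros z' Pz' zz'. apply n'. now exists z'. }
    destruct H as [P [Py [[f Hf] Pz]]].
    destruct (choice (fun u z => (forall s, f s = u -> proj1_sig s = z) /\ ~ ltK y z))
      as [lad Hlad].
    { intros u. destruct (classic (exists s, f s = u)) as [[s <-] | no].
      - exists (proj1_sig s). split.
        + intros s' E. now rewrite (Hf _ _ E).
        + apply (wo_lt_asym WK). apply Py. exact (proj2_sig s).
      - exists y. split; [|apply (wo_irr WK)]. intros s E. destruct no. now exists s. }
    exists lad. split; [apply Hlad|]. intros _ z zy.
    destruct (Pz z zy) as [z' [Pz' zz']]. exists (f (exist _ z' Pz')).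
    rewrite <- (proj1 (Hlad (f (exist _ z' Pz'))) _ eq_refl). auto.
Qed.

Lemma lub_exists (B : K -> Prop) (x : K) : exists y, is_lub B x y.
Proof. apply (wf_min ltK); [apply (wo_wf WK) | now exists x]. Qed.

Lemma path_le {Y : Type} (B : K -> Prop) (top : K -> K) (lad : K -> Y -> K) :
  (forall x, is_lub B x (top x)) -> (forall y, is_ladder y (lad y)) ->
  forall t x, ~ ltK x (path top lad t x).
Proof.
  intros Htop Hlad t.
  assert (H : forall x, ~ ltK x (top x)) by (intros x; now apply (Htop x)).
  induction t as [|u t IH]; intros x; simpl; auto.
  refine (wo_le_trans WK _ _ _ (IH _) _).
  refine (wo_le_trans WK _ _ _ _ (H x)). apply Hlad.
Qed.

(* As n grows each top only decreases, so it is eventually constant; a path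
   whose steps are chosen among the eventual values descends, hence is finite,
   and it stops at a point of large cofinality. *)
Lemma path_stabilizes {Y : Type} (N : nat -> K -> K) (top : nat -> K -> K)
  (lad : K -> Y -> K) (m : K) :
  (forall n k x, n <= k -> closed_under (N k) x -> closed_under (N n) x) ->
  (forall n x, is_lub (fun z => closed_under (N n) z /\ cof_gt_at Y z) x (top n x)) ->
  (forall y, is_ladder y (lad y)) ->
  (forall n, closed_under (N n) m) -> cof_gt_at Y m ->
  forall x, ~ ltK x m -> forall n0, exists n t, n0 <= n /\
    (forall k, n <= k -> closed_under (N k) (path (top n) lad t x)) /\
    cof_gt_at Y (path (top n) lad t x).
Proof.
  intros dec Htop Hlad Nm mY x. induction (wo_wf WK x) as [x _ IH]. intros xm n0.
  assert (anti : forall n k, n <= k -> ~ ltK (top n x) (top k x)).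
  { intros n k nk. apply (Htop k x). intros z [Nz zY] xz. apply (Htop n x); auto.
    split; auto. now apply (dec n k). }
  destruct (wf_min ltK (fun y => exists n, n0 <= n /\ top n x = y) (wo_wf WK))
    as [y [[n1 [n01 Ey]] ymin]].
  { eauto. }
  assert (cst : forall k, n1 <= k -> top k x = y).
  { intros k n1k. apply (wo_antisym WK).
    - apply ymin. exists k. split; auto. lia.
    - rewrite <- Ey. auto. }
  destruct (classic (cof_gt_at Y y)) as [yY | yY].
  - exists n1, []. split; [exact n01|]. simpl. rewrite Ey. split; [|exact yY].
    (* [y] is a supremum of points closed under [N k], hence is closed itself. *)
    intros k n1k w wy h.
    apply (proj2 (Htop k x) w); [|now rewrite (cst k n1k)].
    intros z [Nz zY] xz wz.
    apply (Nz w wz). apply (wo_le_lt WK _ y); auto.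
    rewrite <- (cst k n1k). apply (Htop k x); auto.
  (* [m] is a target at every stage and keeps the descent above it: the ladder at [y] has a rung
     strictly between [m] and [y]. *)
  - assert (my : ltK m y).
    { destruct (wo_total WK m y) as [h | [<- | h]]; [exact h | easy |].
      exfalso. rewrite <- Ey in h. exact (proj1 (Htop n1 x) m (conj (Nm n1) mY) xm h). }
    destruct (proj2 (Hlad y) yY m my) as [u [mu uy]].
    assert (yx : ~ ltK x y).
    { rewrite <- Ey. now apply (Htop n1 x). }
    destruct (IH (lad y u)) with (n0 := n1) as [n [t [n1n [Ht HY]]]].
    + now apply (wo_lt_le WK _ y).
    + now apply (wo_lt_asym WK).
    + exists n, (u :: t). simpl. rewrite (cst n n1n). split; [lia | auto].
Qed.

(** * Club guessing, and guessing for singular [L] *)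

Section Singular.

Context (P : L -> Prop) (unbounded : forall v, exists w, P w /\ ~ ltL w v).
Context (few : ~ inj L (subtype_of P * nat)).
Context (small : forall i, ~ inj L (tree (segment ltL i))).
Context (top : (K -> Prop) -> K -> K) (top_lub : forall B x, is_lub B x (top B x)).
Context (lad : forall i, K -> tree (segment ltL i) -> K).
Context (lad_ladder : forall i y, is_ladder y (lad i y)).

(** Cofinality above the size of the trees, not just of the segment, since the paths are finite
    lists of tree indices. *)
Definition targets (i : L) (N : K -> K) (z : K) : Prop :=
  closed_under N z /\ cof_gt_at (tree (segment ltL i)) z.

Definition endpoint (i : L) (N : K -> K) (t : list (tree (segment ltL i))) (y : K) : K :=
  path (top (targets i N)) (lad i) t y.

(* If no N0 works, iterate L times the passage from N0 to an N that it fails to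
   guess; by pigeonhole the failure occurs at one i along an increasing omega
   sequence of stages, where the paths stabilize. *)
Lemma club_guess :
  exists N0, forall N, exists y, forall j, exists i, P i /\ ~ ltL i j /\
    exists t, targets i N (endpoint i N0 t y).
Proof.
  apply NNPP. intros no.
  assert (H : forall N0, exists N, forall y, exists i, P i /\
    forall t, ~ targets i N (endpoint i N0 t y)).
  { intros N0. apply NNPP. intros n. apply no. exists N0. intros N. apply NNPP.
    intros n1. apply n. exists N. intros y. apply NNPP. intros n2. apply n1. exists y.
    intros j. apply NNPP. intros n3. apply n2.
    destruct (unbounded j) as [i [Pi ij]]. exists i. split; auto. intros t Ht.
    apply n3. eauto. }
  destruct (choice _ H) as [Phi HPhi].
  destruct (chain ltL (fun _ : K -> K => True) (fun N M => forall x, closed_under M x ->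
    closed_under N x /\ closed_under (Phi N) x) (wo_wf WL)) as [f Hf].
  { intros v g.
    destruct (choice (fun y t => forall s, ltK (g s y) t /\ ltK (Phi (g s) y) t)) as [M HM].
    - assert (vL : inj (segment ltL v) L).
      { exists (@proj1_sig _ _). intros [a ha] [b hb]. simpl. intros.
        now apply subset_eq_compat. }
      intros y. destruct (bounded (fun s => g s y) vL) as [b1 H1].
      destruct (bounded (fun s => Phi (g s) y) vL) as [b2 H2].
      destruct (above b1 b2) as [b [h1 h2]]. exists b. intros s.
      split; [exact (wo_trans WK _ _ _ (H1 s) h1) | exact (wo_trans WK _ _ _ (H2 s) h2)].
    - exists M. split; auto. intros s x Mx.
      split; intros y yx h; apply (Mx y yx); apply (wo_trans WK _ _ _ h); apply HM. }
  assert (LL : inj L L) by now exists (fun x => x).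
  (* [M] dominates every stage, so each [m i] is a target at all stages at once, as the
     stabilization of paths requires. *)
  destruct (choice (fun y t => forall v, ltK (f v y) t)) as [M HM].
  { intros y. exact (bounded (fun v => f v y) LL). }
  destruct (choice (fun i => targets i M)) as [m Hm].
  { intros i. apply tree_closed_point. apply small. }
  destruct (bounded m LL) as [y Hy].
  destruct (choice (fun v (i : subtype_of P) => forall t,
    ~ targets (proj1_sig i) (Phi (f v)) (endpoint (proj1_sig i) (f v) t y))) as [bad Hbad].
  { intros v. destruct (HPhi (f v) y) as [i [Pi Hi]]. now exists (exist _ i Pi). }
  destruct (increasing_in_fiber bad few) as [v [vinc [i Hi]]].
  destruct (path_stabilizes (fun n => f (v n))
    (fun n => top (targets (proj1_sig i) (f (v n)))) (lad (proj1_sig i)) (m (proj1_sig i)))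
    with (x := y) (n0 := 0) as [n [t [_ [Ht tY]]]].
  - intros n k x nk Nx. destruct (PeanoNat.Nat.eq_dec n k) as [<- | ne]; auto.
    apply (Hf (v k)); auto. apply vinc. lia.
  - intros n x. apply top_lub.
  - apply lad_ladder.
  - intros n z zm h. destruct (Hm (proj1_sig i)) as [Mm _]. apply (Mm z zm).
    apply (wo_trans WK _ _ _ h). apply HM.
  - apply Hm.
  - apply (wo_lt_asym WK). apply Hy.
  - apply (Hbad (v n)) with
      (t := eq_rect_r (fun i => list (tree (segment ltL (proj1_sig i)))) t (Hi n)).
    rewrite (Hi n). unfold eq_rect_r. simpl. split; [|exact tY].
    (* The club of the next stage lies inside the one given by [Phi (f (v n))], which stage [v n]
       was supposed to miss. *)
    apply (Hf (v (S n))); [apply vinc; lia|]. apply Ht. lia.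
Qed.

End Singular.

Lemma guessing_singular (C : Type) (i0 : L) (P : L -> Prop) :
  le_cf C ltL -> inj (subtype_of P) (segment ltL i0 * segment ltL i0) ->
  (forall v, exists w, P w /\ ~ ltL w v) ->
  exists D, guessing C D.
Proof.
  intros HC Pi0 unbounded.
  (* A finite segment would make [P] finite, and no finite set is cofinal in [L]. *)
  assert (inf : inj nat (segment ltL i0)).
  { destruct (finite_or_inj_nat (segment ltL i0)) as [h | fin]; [exact h|]. exfalso.
    destruct (finite_or_inj_nat (subtype_of P)) as [h | [l Hl]].
    - exact (finite_not_inj_nat _ (finite_prod _ _ fin fin) (inj_trans h Pi0)).
    - destruct (list_bounded (map (@proj1_sig _ _) l)) as [v Hv].
      destruct (unbounded v) as [w [Pw h]]. apply h, Hv.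
      change w with (proj1_sig (exist P w Pw)). now apply in_map. }
  assert (small : forall i, ~ inj L (tree (segment ltL i))).
  { assert (H : forall i, inj nat (segment ltL i) -> ~ inj L (tree (segment ltL i))).
    { intros i infi h. apply (proj2 (proj2 HL) i).
      exact (inj_trans h (segment_tree ltL WL i infi)). }
    intros i h. destruct (classic (ltL i i0)) as [lt | ge].
    - apply (H i0 inf). apply (inj_trans h). apply inj_tree_mono.
      apply inj_segment_mono; [exact WL|]. now apply (wo_lt_asym WL).
    - apply (H i); auto. apply (inj_trans inf). now apply inj_segment_mono. }
  assert (few : ~ inj L (subtype_of P * nat)).
  { intros h. apply (proj2 (proj2 HL) i0). apply (inj_trans h).
    pose proof (segment_square ltL WL i0 inf) as sq.
    apply (inj_trans (inj_prod (inj_trans Pi0 sq) inf)). exact sq. }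
  destruct (choice (fun (q : (K -> Prop) * K) y => is_lub (fst q) (snd q) y)) as [top0 Htop0].
  { intros [B x]. apply lub_exists. }
  set (top := fun B x => top0 (B, x)).
  assert (top_lub : forall B x, is_lub B x (top B x)) by (intros B x; apply (Htop0 (B, x))).
  destruct (dep_choice (fun i (lad : K -> tree (segment ltL i) -> K) =>
    forall y, is_ladder y (lad y))) as [lad lad_ladder].
  { intros i. apply choice. apply ladder_exists. }
  destruct (club_guess P unbounded few small top top_lub lad lad_ladder) as [N0 HN0].
  destruct enumerations as [r [e He]].
  exists (fun i y x => exists l t, ltL l i /\ x = endpoint top lad i N0 t (e y l)).
  intros N. destruct (HN0 N) as [h Hh]. exists h. intros S g SC CS hg.
  destruct (small_segment (fun s => r h (g s)) HC SC CS) as [j Hj].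
  destruct (Hh j) as [i [_ [ij [t [Nx xY]]]]].
  destruct (Hj i ij) as [ri Si].
  set (x := endpoint top lad i N0 t h) in *.
  assert (xh : ~ ltK h x).
  { apply (path_le (targets i N0)); [apply top_lub | apply lad_ladder]. }
  destruct (cof_gt_at_range (Y := tree (segment ltL i))
    (fun q : S * segment ltL i * list (tree (segment ltL i)) =>
      endpoint top lad i N0 (snd q) (e (g (fst (fst q))) (proj1_sig (snd (fst q))))) x)
    as [z [zx Hz]].
  { exact xY. }
  (* A starting point and a path together are coded by one tree, so the endpoints are too few to be
     cofinal in [x]. *)
  { destruct Si as [f Hf].
    exists (fun q => Node (Leaf (f (fst (fst q))))
      (Node (Leaf (snd (fst q))) (tree_of_list (snd q)))).
    intros [[a b] d] [[a' b'] d'] E. injection E as E1 E2 E3.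
    apply Hf in E1. apply tree_of_list_inj in E3. simpl in *. congruence. }
  exists i, x, z. split; [exact Nx|]. split; [exact zx|]. intros s. split; [|split].
  - exact (wo_le_lt WK _ _ _ xh (hg s)).
  - exists (r h (g s)), t. split; auto. now rewrite He.
  - intros y [l [u [li ->]]] lt. exact (Hz (s, exist _ l li, u) lt).
Qed.

(** The case hypothesis expresses regularity of [L]; its failure supplies a cofinal [P] no larger
    than the square of a segment. *)
Lemma guessing_exists (C : Type) : le_cf C ltL -> exists D, guessing C D.
Proof.
  intros HC.
  destruct (classic (forall i, cof_gt (segment ltL i * segment ltL i) ltL)) as [reg | sing].
  - now apply guessing_regular.
  - apply not_all_ex_not in sing. destruct sing as [i0 sing].
    apply not_all_ex_not in sing. destruct sing as [P sing].
    apply imply_to_and in sing. destruct sing as [Pi0 sing].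
    apply (guessing_singular C i0 P HC Pi0).
    intros v. apply NNPP. intros n. apply sing. exists v. intros w Pw. apply NNPP.
    intros n'. apply n. now exists w.
Qed.

End Successor.

Theorem theoremA (L : Type) (ltL : L -> L -> Prop) (K : Type) (ltK : K -> K -> Prop)
  (C : Type) (p : K -> K -> L) :
  infinite_cardinal ltL ->
  successor_of L ltK ->
  le_cf C ltL ->
  (pr1 ltK L C p <-> pr1 ltK K C p).
Proof.
  intros HL HK HC. split.
  - destruct (guessing_exists HL HK C HC) as [D HD].
    exact (pr1_pump HL HK C D p (le_cf_inj HL HC) HD).
  - exact (pr1_restrict HL HK C p).
Qed.
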